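(* Let $k\geq 2$ be an integer. For a positive integer $n$, let $\mu_k(n)$ denote the maximum size of a subset $S\subseteq [n]\times[n]$ such that there are no elements $\mathbf{a}_1,\ldots,\mathbf{a}_k\in S$ (not necessarily distinct) with $\mathbf{a}_1+\cdots+\mathbf{a}_k=(n,n)$, and let $\nu_k(n)=\mu_k(n)/n^2$. Then, as $n\to\infty$, \[\nu_k(n)=\frac{k^2-2}{k^2}+O\left(\frac{1}{n}\right).\]
   Context: For a positive integer $n$, $[n]=\{1,\ldots,n\}$. Addition of lattice points is coordinatewise. The implied constant in $O(\cdot)$ may depend on $k$. *)

(* Defs.v *)
From mathcomp Require Import all_boot all_order all_algebra.
From mathcomp Require Import all_classical all_reals all_analysis.

Set Implicit Arguments.
Unset Strict Implicit.
Unset Printing Implicit Defensive.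

Import GRing.Theory Num.Theory.

(* The points of [n] x [n], [n] = {1, ..., n}, inside {0, ..., n}^2, so that
   coordinates keep their actual values. *)
Definition grid (n : nat) : {set 'I_n.+1 * 'I_n.+1} :=
  [set p : 'I_n.+1 * 'I_n.+1 | (0 < p.1)%N && (0 < p.2)%N].

Definition sum_avoiding (k n : nat) (S : {set 'I_n.+1 * 'I_n.+1}) : bool :=
  ~~ [exists a : {ffun 'I_k -> 'I_n.+1 * 'I_n.+1},
       [&& [forall i, a i \in S],
           (\sum_(i < k) (a i).1 == n)%N &
           (\sum_(i < k) (a i).2 == n)%N]].

Definition mu (k n : nat) : nat :=
  \max_(S : {set 'I_n.+1 * 'I_n.+1} | (S \subset grid n) && sum_avoiding k S)
     #|S|.

Definition nu (R : realType) (k n : nat) : R := ((mu k n)%:R / n%:R ^+ 2)%R.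

(* Main.v *)
Require Import Defs.
From mathcomp Require Import all_boot all_order all_algebra.
From mathcomp Require Import zify ring lra.
From mathcomp Require Import all_classical all_reals all_analysis.
Import Order.TTheory GRing.Theory Num.Theory.

(**
  Lower bound: keep the points with k (x + y) > 2 n.

  Upper bound: let T be the complement of S in the grid and t(x) the size of the
  column of T above x.  If x_1 + ... + x_k = n, the columns of S above the x_i
  contain no y_1 + ... + y_k = n, which forces n < k + t(x_1) + ... + t(x_k).
  Averaging over tuples (x_1, ..., x_k) with sum n whose coordinates are all
  equidistributed on an interval {1, ..., m} with m close to 2 n / k gives
  k |T| >= m (n + 1 - k), up to shifting the last coordinate by n mod k.
*)

(** * Gaps forced by an unattainable sum *)

(** Induction on the number of sets. For two sets, each y in 1, ..., n - 1 yields a gap, at y in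
    [A 0] or at n - y in [A 1]. For more, either the last set has no element below n, which already
    gives n - 1 gaps, or one of its elements is fixed as the last summand and the remaining sets
    must avoid a smaller sum. *)
Lemma sum_complements_gt (k n : nat) (A : nat -> pred nat) : 1 < k ->
  (forall y : nat -> nat, (forall i, i < k -> 0 < y i /\ A i (y i)) ->
     \sum_(i < k) y i != n) ->
  n < k + \sum_(i < k) \sum_(1 <= y < n) ~~ A i y.
Proof.
elim: k n => // k IHk n; rewrite ltnS leq_eqVlt => /predU1P[<-|k_gt1] avoidA.
  rewrite !big_ord_recl big_ord0 addn0 /= /bump /=.
  rewrite [X in _ < _ + (_ + X)]big_nat_rev /= -big_split /=.
  suff: \sum_(1 <= y < n) 1 <=
        \sum_(1 <= y < n) ((~~ A 0 y) + (~~ A 1 (1 + n - y.+1))).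
    by rewrite sum_nat_const_nat addn0; lia.
  rewrite big_nat [leqRHS]big_nat; apply: leq_sum => y /andP[y_gt0 y_lt].
  case A0: (A 0 y); case A1: (A 1 (1 + n - y.+1)) => //.
  pose y2 i := if i == 0 then y else 1 + n - y.+1.
  have /avoidA/eqP[] : forall i, i < 2 -> 0 < y2 i /\ A i (y2 i).
    by rewrite /y2; case=> [|[|i]] // _; split=> //=; lia.
  by rewrite !big_ord_recl big_ord0 /y2 /=; lia.
rewrite big_ord_recr /=.
case: (pselect (exists m, (0 < m < n) && A k m)) => [exm|noA]; last first.
  have: \sum_(1 <= y < n) 1 <= \sum_(1 <= y < n) ~~ A k y.
    rewrite big_nat [leqRHS]big_nat; apply: leq_sum => y yn.
    by case Ay: (A k y) => //; case: noA; exists y; rewrite yn.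
  by rewrite sum_nat_const_nat; lia.
(* Spending the least element m of A_k costs the m - 1 smaller gaps of A_k. *)
have [m /andP[/andP[m_gt0 m_lt] Am] m_min] := ex_minnP exm.
have gapm : m.-1 <= \sum_(1 <= y < n) ~~ A k y.
  rewrite (big_cat_nat (n := m)) //=; last exact: ltnW.
  apply: leq_trans (leq_addr _ _).
  have: \sum_(1 <= y < m) 1 <= \sum_(1 <= y < m) ~~ A k y.
    rewrite big_nat [leqRHS]big_nat; apply: leq_sum => y /andP[y_gt0 y_lt].
    by case Ay: (A k y) => //; have := m_min y; rewrite Ay; lia.
  by rewrite sum_nat_const_nat; lia.
have gapI : \sum_(i < k) \sum_(1 <= y < n - m) ~~ A i y <=
            \sum_(i < k) \sum_(1 <= y < n) ~~ A i y.
  apply: leq_sum => i _; rewrite [leqRHS](big_cat_nat (n := n - m)) //=; first 1 last.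
  - lia.
  - lia.
  exact: leq_addr.
suff /(IHk _ k_gt1): forall y : nat -> nat,
    (forall i, i < k -> 0 < y i /\ A i (y i)) -> \sum_(i < k) y i != n - m.
  move: gapm gapI; move: (\sum_(1 <= y < n) ~~ A k y).
  by move: (\sum_(i < k) _) (\sum_(i < k) _) => *; lia.
move=> y Ay; apply/eqP => sum_y.
pose y2 i := if i == k then m else y i.
have /avoidA/eqP[] : forall i, i < k.+1 -> 0 < y2 i /\ A i (y2 i).
  by move=> i; rewrite /y2 ltnS leq_eqVlt; case: eqP => [-> _|_ /= /Ay //]; split.
rewrite /y2 big_ord_recr /= eqxx (eq_bigr (fun i : 'I_k => y i)) ?sum_y; first by lia.
by move=> i _; rewrite ltn_eqF.
Qed.

(** * Equidistributed tuples with constant sum *)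

Lemma sum_perm_iota (m : nat) (f g : nat -> nat) :
  (forall i, i < m -> f i < m) ->
  (forall i j, i < m -> j < m -> f i = f j -> i = j) ->
  \sum_(0 <= i < m) g (f i) = \sum_(0 <= i < m) g i.
Proof.
move=> f_lt f_inj; rewrite -(big_map f xpredT g); apply: perm_big.
have uf : uniq (map f (index_iota 0 m)).
  rewrite map_inj_in_uniq ?iota_uniq // => i j; rewrite !mem_index_iota.
  exact: f_inj.
have sf : {subset map f (index_iota 0 m) <= index_iota 0 m}.
  by move=> _ /mapP[i + ->]; rewrite !mem_index_iota => /f_lt.
have [|_ eqf] := uniq_min_size uf sf; first by rewrite size_map.
by apply: uniq_perm; rewrite ?iota_uniq.
Qed.

(** Each [f i] permutes {0, ..., 2 r}; this is phrased through sums of an arbitrary [g], the form in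
    which columns are averaged later. Appending the pair j, 2 r - j raises k by 2 and the sum by 2
    r, so k = 2 and k = 3 start the induction. *)
Lemma constant_sum_permutations (k r : nat) : 1 < k ->
  exists f : nat -> nat -> nat,
  (forall j, j < r.*2.+1 -> \sum_(i < k) f i j = k * r) /\
  (forall i (g : nat -> nat), i < k ->
     \sum_(0 <= j < r.*2.+1) g (f i j) = \sum_(0 <= j < r.*2.+1) g j).
Proof.
elim/ltn_ind: k => -[|[|[|[|k]]]] // IHk _.
- exists (fun i j => if i == 0 then j else r.*2 - j); split=> [j j_lt|].
    by rewrite !big_ord_recl big_ord0 /=; lia.
  by case=> [|[|i]] // g _; apply: (@sum_perm_iota _ (fun j => r.*2 - j)) => *; lia.
- (* j + p j runs once through r, ..., 3 r, so that 3 r - j - p j is again a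
     permutation. *)
  pose p j := if j <= r then j + r else j - r.+1.
  exists (fun i j => if i == 0 then j else if i == 1 then p j
                     else 3 * r - j - p j); split=> [j j_lt|].
    by rewrite !big_ord_recl big_ord0 /= /p; case: leqP; lia.
  case=> [|[|[|i]]] // g _ //=; first apply: sum_perm_iota.
  + by move=> i; rewrite /p; case: ifP; lia.
  + by move=> i j; rewrite /p; case: ifP; case: ifP; lia.
  apply: (@sum_perm_iota _ (fun j => 3 * r - j - p j)).
  + by move=> i; rewrite /p; case: ifP; lia.
  + by move=> i j; rewrite /p; case: ifP; case: ifP; lia.
have [//|//|f [f_sum f_perm]] := IHk k.+2.
exists (fun i j => if i < k.+2 then f i j else if i == k.+2 then j else r.*2 - j).
split=> [j j_lt|i g i_lt].
  rewrite 2!big_ord_recr /= ltnn eqxx ltnNge leqnSn gtn_eqF //=.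
  rewrite (eq_bigr (fun i : 'I_k.+2 => f i j)) ?f_sum //; first by lia.
  by move=> i _; rewrite ltn_ord.
have [/f_perm->//|ki] := ltnP i k.+2; have [//|_] := eqVneq i k.+2.
by apply: (@sum_perm_iota _ (fun j => r.*2 - j)) => *; lia.
Qed.


(** * Counting grid points column by column *)

Lemma sum_ord_pos (n : nat) (F : 'I_n.+1 -> nat) :
  \sum_(x < n.+1 | 0 < x) F x = \sum_(1 <= x < n.+1) F (inord x).
Proof.
rewrite big_mkcond big_ord_recl /= add0n big_add1 big_mkord.
by apply: eq_bigr => i _; congr F; apply: val_inj; rewrite /= inordK ?ltnS.
Qed.

Lemma card_gridD (n : nat) (S : {set 'I_n.+1 * 'I_n.+1}) :
  #|grid n :\: S| = \sum_(1 <= x < n.+1) \sum_(1 <= y < n.+1)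
                      ((inord x, inord y) \notin S).
Proof.
rewrite -sum1_card.
rewrite (eq_bigl (fun p : 'I_n.+1 * 'I_n.+1 => ((0 < p.1) && (0 < p.2)) && (p \notin S))); last first.
  by move=> p; rewrite !inE andbC.
rewrite big_mkcondr (eq_bigr (fun p => ((p.1, p.2) \notin S) : nat)) /=; last first.
  by move=> [x y] _ /=; case: (_ \in S).
rewrite -(pair_big (fun x : 'I_n.+1 => 0 < x) (fun y : 'I_n.+1 => 0 < y)
  (fun x y => ((x, y) \notin S) : nat)) /=.
by rewrite sum_ord_pos; apply: eq_bigr => x _; rewrite sum_ord_pos.
Qed.

Lemma card_grid (n : nat) : #|grid n| = n * n.
Proof.
rewrite -[grid n]finset.setD0 card_gridD.
under eq_bigr do under eq_bigr do rewrite inE.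
by rewrite !sum_nat_const_nat subn1 mulnA muln1.
Qed.

Lemma card_subgrid (n : nat) (S : {set 'I_n.+1 * 'I_n.+1}) :
  S \subset grid n -> #|S| + #|grid n :\: S| = n * n.
Proof. by move=> /finset.setIidPr sub; rewrite -card_grid -(cardsID S (grid n)) sub. Qed.

(** * Upper bound on [mu] *)

Lemma card_avoidC_ge (k n : nat) (S : {set 'I_n.+1 * 'I_n.+1}) : 1 < k <= n ->
  sum_avoiding k S ->
  ((n %/ k).*2).-1 * n.+1 <= k * #|grid n :\: S| + ((n %/ k).*2).-1 * k.
Proof.
case/andP=> k_gt1 le_kn avoidS.
have q_gt0 : 0 < n %/ k by rewrite divn_gt0 //; lia.
have [r qE] : exists r, n %/ k = r.+1 by exists (n %/ k).-1; rewrite prednK.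
have nE := divn_eq n k; rewrite qE in nE *; rewrite doubleS /=.
set d := n %% k in nE.
pose t x := \sum_(1 <= y < n.+1) ((inord x, inord y) \notin S).
have [f [f_sum f_perm]] := constant_sum_permutations k r k_gt1.
(* With n = k (r + 1) + d, the k successors contribute k r + k, and the last coordinate absorbs the
   remainder d. *)
pose x i j := (f i j).+1 + (if i == k.-1 then d else 0).
have x_sum j : j < r.*2.+1 -> \sum_(i < k) x i j = n.
  move=> /f_sum fj; rewrite big_split /= -(eq_bigr _ (fun i _ => addn1 _)).
  rewrite big_split /= fj sum_nat_const card_ord -big_mkcond /=.
  have kk : k.-1 < k by lia.
  rewrite (big_pred1 (Ordinal kk)) //.
  by rewrite [RHS]nE; lia.
have n_lt j : j < r.*2.+1 -> n < k + \sum_(i < k) t (x i j).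
  move=> /x_sum xj.
  pose A i y := (y <= n) && ((inord (x i j), inord y) \in S).
  have /(sum_complements_gt _ _ _ k_gt1) : forall y : nat -> nat,
      (forall i, i < k -> 0 < y i /\ A i (y i)) -> \sum_(i < k) y i != n.
    move=> y Ay; apply: contra avoidS => /eqP sum_y; apply/existsP.
    exists [ffun i : 'I_k => (inord (x i j), inord (y i))].
    apply/and3P; split.
    - by apply/forallP=> i; rewrite ffunE; have [_ /andP[]] := Ay i (ltn_ord i).
    - rewrite -[X in _ == X]xj; apply/eqP/eq_bigr => i _; rewrite ffunE /= inordK //.
      by rewrite ltnS -[X in _ <= X]xj (bigD1 i) //= leq_addr.
    - rewrite -[X in _ == X]sum_y; apply/eqP/eq_bigr => i _; rewrite ffunE /= inordK //.
      by rewrite ltnS -[X in _ <= X]sum_y (bigD1 i) //= leq_addr.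
  move=> /leq_trans; apply; rewrite leq_add2l; apply: leq_sum => i _.
  rewrite /t big_nat_recr //=; last by lia.
  apply: leq_trans (leq_addr _ _); rewrite big_nat [leqRHS]big_nat.
  by apply: leq_sum => y /andP[_ y_lt]; rewrite /A (ltnW y_lt).
(* For fixed i, [x i j] runs once through e + 1, ..., e + 2 r + 1 with e equal to 0 or d. This
   interval lies in [n] because 2 r + 1 <= k (r + 1), so distinct columns of the grid are summed. *)
have t_sum i : i < k -> \sum_(0 <= j < r.*2.+1) t (x i j) <= #|grid n :\: S|.
  move=> /f_perm fi; rewrite /x card_gridD -/t.
  set e := if _ then _ else _.
  rewrite (fi (fun z => t (z.+1 + e))).
  have e_le : e <= d by rewrite /e; case: ifP.
  rewrite [leqRHS](big_cat_nat (n := e.+1)) //=; last by nia.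
  apply: leq_trans (leq_addl _ _).
  rewrite [leqRHS](big_cat_nat (n := e.+1 + r.*2.+1)) //=; [|lia|nia].
  apply: leq_trans (leq_addr _ _).
  rewrite -{1}[e.+1]add0n big_addn addKn.
  by apply: leq_sum => j _; rewrite addnS addSn.
have: \sum_(0 <= j < r.*2.+1) n.+1 <=
      \sum_(0 <= j < r.*2.+1) (k + \sum_(i < k) t (x i j)).
  rewrite big_nat [leqRHS]big_nat; apply: leq_sum => j /andP[_ j_lt].
  exact: n_lt.
rewrite big_split !sum_nat_const_nat /= subn0 => /leq_trans; apply.
rewrite addnC leq_add2r exchange_big /=.
rewrite -[k in k * _]card_ord -sum_nat_const; apply: leq_sum => i _.
exact: t_sum.
Qed.

Lemma mu_le (k n : nat) : 1 < k <= n ->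
  k * mu k n + ((n %/ k).*2).-1 * n.+1 <= k * (n * n) + ((n %/ k).*2).-1 * k.
Proof.
move=> kn; have [S /andP[subS avoidS] muE] : exists2 S : {set 'I_n.+1 * 'I_n.+1},
    (S \subset grid n) && sum_avoiding k S & mu k n = #|S|.
  have [|S] := @eq_bigmax_cond _ (fun S : {set 'I_n.+1 * 'I_n.+1} =>
      (S \subset grid n) && sum_avoiding k S) (fun S => #|S|); last by exists S.
  (* The maximum is attained because the empty set is admissible; it contains no k-tuple since k >
     0. *)
  apply/card_gt0P; exists finset.set0; rewrite unfold_in finset.sub0set /=.
  apply/existsP => -[a /and3P[/forallP a0 _ _]].
  have k_gt0 : 0 < k by lia.
  by have := a0 (Ordinal k_gt0); rewrite inE.
rewrite muE -(card_subgrid _ _ subS).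
have := card_avoidC_ge _ _ _ kn avoidS.
by lia.
Qed.

(** * Lower bound on [mu] *)

Lemma card_triangle (m n : nat) :
  (\sum_(1 <= x < n.+1) \sum_(1 <= y < n.+1) (x + y <= m)).*2 <= m * m.
Proof.
have row x : \sum_(1 <= y < n.+1) (x + y <= m) <= m - x.
  elim: n => [|n IHn]; first by rewrite big_geq.
  have cut j : \sum_(1 <= y < j.+1) (x + y <= m) <= j.
    have: \sum_(1 <= y < j.+1) (x + y <= m) <= \sum_(1 <= y < j.+1) 1.
      by apply: leq_sum => y _; exact: leq_b1.
    by rewrite sum_nat_const_nat; lia.
  rewrite big_nat_recr //=; by have := cut n; case: (leqP (x + n.+1) m); lia.
have: \sum_(1 <= x < n.+1) \sum_(1 <= y < n.+1) (x + y <= m) <=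
      \sum_(1 <= x < n.+1) (m - x) by apply: leq_sum => x _; exact: row.
(* The extra square makes the induction on n close: with a = m - n >= 1, the new row and the new
   square contribute 2 (a - 1) + (a - 1)^2 <= a^2. *)
suff: (\sum_(1 <= x < n.+1) (m - x)).*2 + (m - n) * (m - n) <= m * m by lia.
elim: n {row} => [|n IHn]; first by rewrite big_geq //; lia.
rewrite big_nat_recr //=; nia.
Qed.

Lemma mu_ge (k n : nat) : 0 < k ->
  k ^ 2 * n ^ 2 <= k ^ 2 * mu k n + 2 * n ^ 2.
Proof.
move=> k_gt0.
pose S := [set p in grid n | n.*2 < k * (p.1 + p.2)].
have subS : S \subset grid n by apply/fintype.subsetP => p; rewrite inE => /andP[].
have avoidS : sum_avoiding k S.
  apply/existsP => -[a /and3P[/forallP aS /eqP a1 /eqP a2]].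
  (* Summing the defining inequality over a forbidden tuple would give k (2 n + 1) <= k (2 n). *)
  have: \sum_(i < k) n.*2.+1 <= \sum_(i < k) k * ((a i).1 + (a i).2).
    by apply: leq_sum => i _; have := aS i; rewrite inE => /andP[].
  by rewrite sum_nat_const card_ord -big_distrr big_split /= a1 a2; nia.
have S_le : #|S| <= mu k n.
  by apply: (@leq_bigmax_cond _ _ (fun S : {set 'I_n.+1 * 'I_n.+1} => #|S|)); rewrite subS.
have cardS := card_subgrid _ _ subS.
(* The removed points form the triangle x + y <= floor(2 n / k), hence number at most 2 n^2 /
   k^2. *)
have T_le : #|grid n :\: S|.*2 <= (n.*2 %/ k) * (n.*2 %/ k).
  rewrite card_gridD; apply: leq_trans (card_triangle _ n); rewrite leq_double.
  rewrite big_nat [leqRHS]big_nat; apply: leq_sum => x xn.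
  rewrite big_nat [leqRHS]big_nat; apply: leq_sum => y yn.
  rewrite !inE /= !inordK; try by lia.
  rewrite leq_divRL //; move: xn yn => /andP[-> _] /andP[-> _] /=.
  by rewrite -leqNgt mulnC.
have := leq_divM n.*2 k; move: S_le cardS T_le; rewrite !expnS !expn0 !muln1.
set q := n.*2 %/ k; set s := #|S|; set t := #|_ :\: _|; set m := mu k n.
move=> sm st tq qk.
have: (q * k) * (q * k) <= n.*2 * n.*2 by rewrite leq_mul.
have : k * k * t.*2 <= k * k * (q * q) by rewrite leq_mul2l tq orbT.
have : k * k * s <= k * k * m by rewrite leq_mul2l sm orbT.
rewrite -st; nia.
Qed.

(** * Error term and asymptotics *)

Lemma mu_le_linear_error (k n : nat) : 1 < k <= n ->
  k ^ 2 * mu k n + 2 * n ^ 2 <= k ^ 2 * n ^ 2 + 5 * k * n.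
Proof.
move=> kn; have := mu_le _ _ kn; case/andP: kn => k_gt1 le_kn.
have q_gt0 : 0 < n %/ k by rewrite divn_gt0 //; lia.
have := ltn_ceil n (ltnW k_gt1).
rewrite !expnS !expn0 !muln1; move: (n %/ k) (mu k n) q_gt0 => q u q_gt0.
have [m mE] : exists m, m.+1 = q.*2 by exists (q.*2).-1; lia.
rewrite -mE /= => nq le_u.
(* Here n < k (q + 1) and m = 2 q - 1. The constant 5 comes from (2 n - 3 k) (n - k) >= 2 n^2 - 5 k
   n. *)
have km : n.*2 <= k * m + 3 * k by nia.
have le1 : k * (k * u) + k * m * (n - k) <= k * (k * (n * n)) by nia.
have le2 : n.*2 * (n - k) <= (k * m + 3 * k) * (n - k) by rewrite leq_mul2r km orbT.
nia.
Qed.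

Import numFieldNormedType.Exports.
Local Open Scope classical_set_scope.
Local Open Scope ring_scope.

Theorem theorem1p2 (R : realType) (k : nat) (hk : (2 <= k)%N) :
  (fun n : nat => nu R k n) =
    (fun n : nat => (k%:R ^+ 2 - 2) / k%:R ^+ 2) +O_\oo (fun n : nat => n%:R^-1 : R).
Proof.
apply/eqaddOP.
near=> c; near=> n.
have kn : (1 < k <= n)%N by rewrite hk /=; near: n; exists k.
have k_gt0 : 0 < k%:R :> R by rewrite ltr0n ltnW.
have n_gt0 : 0 < n%:R :> R by rewrite ltr0n; lia.
have k_ge1 : 1 <= k%:R :> R by rewrite ler1n ltnW.
have := mu_ge k n (ltnW hk); have := mu_le_linear_error _ _ kn.
rewrite -!(ler_nat R) !(natrD, natrX, natrM) => hi lo.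
(* Over the denominator k^2 n^2, the numerator is nonnegative by [lo] and at most 5 k n by [hi], so
   the error is at most 5 / (k n) <= 5 / n and any c >= 5 works. *)
have -> : (nu R k - (fun=> (k%:R ^+ 2 - 2) / k%:R ^+ 2)) n =
  (k%:R ^+ 2 * (mu k n)%:R + 2 * n%:R ^+ 2 - k%:R ^+ 2 * n%:R ^+ 2) /
    (k%:R ^+ 2 * n%:R ^+ 2) :> R.
  rewrite /nu /= !fctE; field.
  by rewrite !gt_eqF.
rewrite ger0_norm; last by rewrite divr_ge0 ?mulr_ge0 ?sqr_ge0 //; lra.
rewrite ger0_norm ?invr_ge0 ?(ltW n_gt0) //.
apply: (@le_trans _ _ (5 / n%:R)); last first.
  by rewrite ler_pM2r ?invr_gt0 //; near: c; exact: nbhs_pinfty_ge.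
rewrite ler_pdivrMr ?mulr_gt0 ?exprn_gt0 //.
have -> : 5 / n%:R * (k%:R ^+ 2 * n%:R ^+ 2) = 5 * k%:R * n%:R * k%:R :> R.
  by field; rewrite gt_eqF.
have : 5 * k%:R * n%:R * 1 <= 5 * k%:R * n%:R * k%:R :> R.
  by rewrite ler_pM2l ?mulr_gt0.
by lra.
Unshelve. all: by end_near.
Qed.
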